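(* Let $\mathcal V$ be a congruence modular variety with a $(2)$-dimensional Kiss term $q_2$, and for $n\ge3$ let $q_n$ be the $2^n$-ary terms defined recursively by $$q_n(x_0,\dots,x_{2^n-1})=q_2\big(q_{n-1}(x_0,\dots,x_{2^{n-1}-1}),\,x_{2^{n-1}-1},\,q_{n-1}(x_{2^{n-1}},\dots,x_{2^n-1}),\,x_{2^n-1}\big).$$ Let $\mathbb A\in\mathcal V$, $n\ge2$ and $\theta_0,\dots,\theta_{n-1}\in\mathrm{Con}(\mathbb A)$. For $\gamma\in A^{2^n}$ let $\widehat\gamma\in A^{2^n}$ be given by $\widehat\gamma_f=\gamma_f$ for $f\neq\mathbf 1$ and $\widehat\gamma_{\mathbf 1}=q_n(\gamma_{f_0},\gamma_{f_1},\dots,\gamma_{f_{2^n-1}})$, where $f_m\in 2^n$ is the function with $\sum_{i\in n}f_m(i)2^i=m$ (colexicographic order). If $\gamma\in A^{2^n}$ satisfies $\mathrm{face}_i^j(\gamma)\in\Delta(\{\theta_k\}_{k\in n\setminus\{i\}})$ for every $i\in n$ and $j\in 2$, then $\widehat\gamma\in\Delta(\theta_0,\dots,\theta_{n-1})$.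
   Context: Cube notation. $n=\{0,\dots,n-1\}$, $2=\{0,1\}$; for finite $S\subseteq\mathbb N$, $2^S$ is the set of functions $S\to2$, $\mathbf 1$ the constant function $1$; an $(S)$-cube over $A$ is $\gamma\in A^{2^S}$. For $i\in S$, $j\in 2$: $\mathrm{face}_i^j(\gamma)\in A^{2^{S\setminus\{i\}}}$ is $g\mapsto\gamma_{g\cup\{(i,j)\}}$; $\mathrm{face}_i(R)=\{(\mathrm{face}_i^0\gamma,\mathrm{face}_i^1\gamma):\gamma\in R\}$; $\mathrm{glue}_{\{i\}}(\zeta,\eta)$ is the cube with $\mathrm{face}_i^0=\zeta$, $\mathrm{face}_i^1=\eta$; $\mathrm{refl}_i^j(\gamma)=\mathrm{glue}_{\{i\}}(\mathrm{face}_i^j\gamma,\mathrm{face}_i^j\gamma)$; $\mathrm{sym}_i(\gamma)=\mathrm{glue}_{\{i\}}(\mathrm{face}_i^1\gamma,\mathrm{face}_i^0\gamma)$; $\mathrm{cube}_i(x,y)$ has value $x$ where $f(i)=0$ and $y$ where $f(i)=1$. Cubes indexed by a one-element set are identified with pairs. A subuniverse $R\le\mathbb A^{2^S}$ is an $(|S|)$-dimensional congruence of $\mathbb A$ if $\mathrm{refl}_i^j(\gamma),\mathrm{sym}_i(\gamma)\in R$ for all $\gamma\in R$, $i\in S$, $j\in 2$, and each $\mathrm{face}_i(R)$ is transitive. For $\theta_k\in\mathrm{Con}(\mathbb A)$ ($k\in S$), $\Delta(\{\theta_k\}_{k\in S})$ is the smallest $(|S|)$-dimensional congruence of $\mathbb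 A$ containing the subuniverse $M(\{\theta_k\}_{k\in S})$ of $\mathbb A^{2^S}$ generated by all $\mathrm{cube}_k(x,y)$ with $k\in S$, $(x,y)\in\theta_k$; for $S=n$ write $\Delta(\theta_0,\dots,\theta_{n-1})$; for $|S|=1$, $\Delta(\theta)=\theta$. Squares and $\mathrm{Rect}$. For $\alpha,\beta\in\mathrm{Con}(\mathbb A)$, $\mathrm{Rect}(\alpha,\beta)$ is the set of $\gamma\in A^{2^2}$ with $(\gamma_{00},\gamma_{10}),(\gamma_{01},\gamma_{11})\in\alpha$ and $(\gamma_{00},\gamma_{01}),(\gamma_{10},\gamma_{11})\in\beta$, where $\gamma_{ab}$ is the value at $f$ with $f(0)=a,f(1)=b$. The binary term condition commutator $[\alpha,\beta]_{TC}$ is the least $\delta$ such that for each $\gamma\in M(\alpha,\beta)$ and $i\in 2$, if the $i$-direction line of $\gamma$ not containing $\gamma_{11}$ lies in $\delta$ then so does the $i$-direction line containing $\gamma_{11}$. Kiss term. A $4$-ary term $q_2$ is a $(2)$-dimensional Kiss term for $\mathcal V$ if $q_2(x,x,y,y)\approx q_2(x,y,x,y)\approx y$ in $\mathcal V$ and for all $\mathbb A\in\mathcal V$, $\alpha,\beta\in\mathrm{Con}(\mathbb A)$, whenever the squares $(\gamma_{00},\gamma_{10},\gamma_{01},\gamma_{11})=(a,b,c,d)$ and $(a,b,c,d')$ lie in $\mathrm{Rect}(\alpha,\beta)$, $(q_2(a,b,c,d),q_2(a,b,c,d'))\in[\alpha,\beta]_{TC}$. Every congruence modular variety has a $(2)$-dimensional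 Kiss term (Kiss). *)

(* Defs.v *)
From mathcomp Require Import all_boot.
Set Implicit Arguments. Unset Strict Implicit. Unset Printing Implicit Defensive.

Record signature := Signature { op : Type; arity : op -> nat }.

Record algebra (sg : signature) := Algebra {
  carrier :> Type;
  interp : forall o : op sg, ('I_(arity o) -> carrier) -> carrier }.
Arguments interp {sg} a o _.

Inductive term (sg : signature) (X : Type) : Type :=
| Var of X
| App (o : op sg) of ('I_(arity o) -> term sg X).
Arguments Var {sg X} _.
Arguments App {sg X} o _.

Fixpoint eval (sg : signature) (A : algebra sg) (X : Type) (v : X -> A)
    (t : term sg X) : A :=
  match t with
  | Var x => v x
  | App o ts => interp A o (fun k => eval v (ts k))
  end.

Fixpoint subst (sg : signature) (X Y : Type) (s : X -> term sg Y)
    (t : term sg X) : term sg Y :=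
  match t with
  | Var x => s x
  | App o ts => App o (fun k => subst s (ts k))
  end.

(* A variety is the class of all models of a set Sigma of identities
   (Birkhoff); identities are pairs of terms in variables from nat. *)
Definition in_variety (sg : signature) (Sigma : term sg nat * term sg nat -> Prop)
    (A : algebra sg) : Prop :=
  forall e, Sigma e -> forall v : nat -> A, eval v e.1 = eval v e.2.

Definition is_congruence (sg : signature) (A : algebra sg) (th : A -> A -> Prop) :=
  [/\ (forall x, th x x), (forall x y, th x y -> th y x),
      (forall x y z, th x y -> th y z -> th x z) &
      (forall o (x y : 'I_(arity o) -> A), (forall k, th (x k) (y k)) ->
         th (interp A o x) (interp A o y))].
Arguments is_congruence {sg} A th.

Definition cg_join (sg : signature) (A : algebra sg) (al be : A -> A -> Prop) (x y : A) :=
  forall de, is_congruence A de -> (forall u v, al u v -> de u v) ->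
    (forall u v, be u v -> de u v) -> de x y.

Definition congruence_modular_variety (sg : signature)
    (Sigma : term sg nat * term sg nat -> Prop) : Prop :=
  forall A : algebra sg, in_variety Sigma A ->
  forall al be ga : A -> A -> Prop,
    is_congruence A al -> is_congruence A be -> is_congruence A ga ->
    (forall x y, al x y -> ga x y) ->
    forall x y, cg_join al (fun u v => be u v /\ ga u v) x y <->
                (cg_join al be x y /\ ga x y).

Definition cube (A : Type) (I : finType) := {ffun {ffun I -> bool} -> A}.

Definition ext (I : finType) (i : I) (j : bool) (g : {ffun {k : I | k != i} -> bool})
  : {ffun I -> bool} :=
  [ffun k => if (insub k : option {k0 : I | k0 != i}) is Some k' then g k' else j].

Definition restr (I : finType) (i : I) (f : {ffun I -> bool})
  : {ffun {k : I | k != i} -> bool} := [ffun k => f (val k)].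

Definition face (A : Type) (I : finType) (i : I) (j : bool) (g : cube A I)
  : cube A {k : I | k != i} := [ffun h => g (ext j h)].

Definition glue (A : Type) (I : finType) (i : I) (z e : cube A {k : I | k != i})
  : cube A I := [ffun f : {ffun I -> bool} => if f i then e (restr i f) else z (restr i f)].

Definition refl (A : Type) (I : finType) (i : I) (j : bool) (g : cube A I) : cube A I :=
  glue (face i j g) (face i j g).

Definition sym (A : Type) (I : finType) (i : I) (g : cube A I) : cube A I :=
  glue (face i true g) (face i false g).

Definition cube_at (A : Type) (I : finType) (k : I) (x y : A) : cube A I :=
  [ffun f : {ffun I -> bool} => if f k then y else x].

Definition cube_subuniverse (sg : signature) (A : algebra sg) (I : finType)
    (R : cube A I -> Prop) : Prop :=
  forall o (gs : 'I_(arity o) -> cube A I), (forall k, R (gs k)) ->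
    R [ffun f => interp A o (fun k => gs k f)].

Definition Mgen (sg : signature) (A : algebra sg) (I : finType)
    (th : I -> A -> A -> Prop) (g : cube A I) : Prop :=
  forall R : cube A I -> Prop, cube_subuniverse R ->
    (forall k x y, th k x y -> R (cube_at k x y)) -> R g.

Definition face_rel (A : Type) (I : finType) (i : I) (R : cube A I -> Prop)
    (z e : cube A {k : I | k != i}) : Prop :=
  exists g, R g /\ face i false g = z /\ face i true g = e.
Arguments face_rel {A I} i R z e.

Definition higher_congruence (sg : signature) (A : algebra sg) (I : finType)
    (R : cube A I -> Prop) : Prop :=
  [/\ cube_subuniverse R,
      (forall g i j, R g -> R (refl i j g)),
      (forall g i, R g -> R (sym i g)) &
      (forall i z e w, face_rel i R z e -> face_rel i R e w -> face_rel i R z w)].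

Definition Delta (sg : signature) (A : algebra sg) (I : finType)
    (th : I -> A -> A -> Prop) (g : cube A I) : Prop :=
  forall R : cube A I -> Prop, higher_congruence R ->
    (forall g', Mgen th g' -> R g') -> R g.

Definition pt2 (a b : bool) : {ffun 'I_2 -> bool} :=
  [ffun k : 'I_2 => if val k == 0 then a else b].

Definition two (A : Type) (al be : A -> A -> Prop) : 'I_2 -> A -> A -> Prop :=
  fun k => if val k == 0 then al else be.

Definition TC_condition (sg : signature) (A : algebra sg) (al be de : A -> A -> Prop) :=
  forall g : cube A 'I_2, Mgen (two al be) g ->
    (de (g (pt2 false false)) (g (pt2 true false)) ->
       de (g (pt2 false true)) (g (pt2 true true))) /\
    (de (g (pt2 false false)) (g (pt2 false true)) ->
       de (g (pt2 true false)) (g (pt2 true true))).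

Definition commTC (sg : signature) (A : algebra sg) (al be : A -> A -> Prop) (x y : A) :=
  forall de, is_congruence A de -> TC_condition al be de -> de x y.

(* (gamma00, gamma10, gamma01, gamma11) = (a,b,c,d) in Rect(al,be) *)
Definition in_rect (A : Type) (al be : A -> A -> Prop) (a b c d : A) :=
  [/\ al a b, al c d, be a c & be b d].

Definition vec4 (A : Type) (a b c d : A) : 'I_4 -> A :=
  fun k => match val k with 0 => a | 1 => b | 2 => c | _ => d end.

Definition kiss_term (sg : signature) (Sigma : term sg nat * term sg nat -> Prop)
    (q2 : term sg 'I_4) : Prop :=
  (forall A : algebra sg, in_variety Sigma A -> forall x y : A,
      eval (vec4 x x y y) q2 = y /\ eval (vec4 x y x y) q2 = y) /\
  (forall A : algebra sg, in_variety Sigma A ->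
   forall al be : A -> A -> Prop, is_congruence A al -> is_congruence A be ->
   forall a b c d d' : A, in_rect al be a b c d -> in_rect al be a b c d' ->
     commTC al be (eval (vec4 a b c d) q2) (eval (vec4 a b c d') q2)).

Fixpoint qterm (sg : signature) (q2 : term sg 'I_4) (n : nat) : term sg nat :=
  match n with
  | n'.+1 =>
      if n' < 2 then subst (fun k : 'I_4 => Var (val k)) q2
      else let h := 2 ^ n' in
        subst (fun k : 'I_4 => match val k with
                              | 0 => qterm q2 n'
                              | 1 => Var h.-1
                              | 2 => subst (fun m => Var (h + m)) (qterm q2 n')
                              | _ => Var (2 * h).-1
                              end) q2
  | 0 => subst (fun k : 'I_4 => Var (val k)) q2
  end.

(* f_m : the point of 2^n with sum_i f_m(i) 2^i = m (for m < 2^n) *)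
Definition colex (n m : nat) : {ffun 'I_n -> bool} :=
  [ffun i : 'I_n => odd (m %/ 2 ^ i)].

Definition hat (sg : signature) (A : algebra sg) (q2 : term sg 'I_4) (n : nat)
    (g : cube A 'I_n) : cube A 'I_n :=
  [ffun f => if f == [ffun => true]
             then eval (fun m => g (colex n m)) (qterm q2 n)
             else g f].

(* Main.v *)
Require Import Defs.
From mathcomp Require Import all_boot.
From Stdlib Require Import FunctionalExtensionality ProofIrrelevance.
From Stdlib Require Import Relation_Operators.

Set Implicit Arguments. Unset Strict Implicit. Unset Printing Implicit Defensive.

(** Put R = Delta(theta_0, ..., theta_{n-1}); the faces of the given cube g are faces of R.
Let g_m be g with every vertex whose first m coordinates are 1 replaced by the value of q_m
on the m-dimensional face it closes, where q_1(x_0, x_1) = x_0.  Then g_1 is a degenerate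
cube over a face of g, hence lies in R, and g_n is the hat of g.  To pass from m to m + 1,
split along the direction m: writing z, w for the two faces of g and z', w' for those of
g_m, the faces of g_{m+1} are z and q_2(z', z, w', w).  In the algebra C of faces of R, the
relation R is a congruence beta with z' beta w'.  Hence it suffices to centralize a congruence
rho containing (z, w) by a congruence alpha containing beta and the pairs that agree off the
modified vertices, modulo beta: the Kiss term then gives q_2(z', z, z', w) beta
q_2(z', z, z', z) = z.  That alpha-translation preserves rho-pairs lying in beta is Gumm's
Shifting Lemma among faces of R, and the term condition in the other direction follows from
it by one more use of the Shifting Lemma, inside rho. *)

(** * Evaluation of terms, powers and subalgebras *)

Section Evaluation.
Variable sg : signature.

Lemma eval_hom (A B : algebra sg) (h : A -> B) (X : Type) (v : X -> A) t :
  (forall o x, h (interp A o x) = interp B o (fun k => h (x k))) ->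
  h (eval v t) = eval (fun x => h (v x)) t.
Proof.
move=> hh; elim: t => [//|o ts IH] /=; rewrite hh; congr interp.
exact: functional_extensionality.
Qed.

Lemma eval_subst (A : algebra sg) (X Y : Type) (s : X -> term sg Y) (v : Y -> A) t :
  eval v (subst s t) = eval (fun x => eval v (s x)) t.
Proof.
elim: t => [//|o ts IH] /=; congr interp.
exact: functional_extensionality.
Qed.

Lemma eval_cong (A : algebra sg) th (X : Type) (v w : X -> A) t :
  is_congruence A th -> (forall x, th (v x) (w x)) -> th (eval v t) (eval w t).
Proof. by move=> [_ _ _ comp] vw; elim: t => [//|o ts IH] /=; apply: comp. Qed.

Lemma eq_eval (A : algebra sg) (X : Type) (v w : X -> A) t :
  v =1 w -> eval v t = eval w t.
Proof. by move=> vw; congr eval; apply: functional_extensionality. Qed.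

Definition cube_alg (A : algebra sg) (I : finType) : algebra sg :=
  @Algebra sg (cube A I) (fun o gs => [ffun f => interp A o (fun k => gs k f)]).

Lemma eval_cube (A : algebra sg) (I : finType) (X : Type) (v : X -> cube_alg A I) t f :
  (eval v t : cube A I) f = eval (fun x => (v x : cube A I) f) t.
Proof.
by apply: (@eval_hom (cube_alg A I) A (fun Z : cube A I => Z f)) => o x; rewrite ffunE.
Qed.

Lemma cube_alg_in_variety (Sigma : term sg nat * term sg nat -> Prop) (A : algebra sg)
    (I : finType) :
  in_variety Sigma A -> in_variety Sigma (cube_alg A I).
Proof. by move=> VA e He v; apply/ffunP => f; rewrite !eval_cube; apply: VA. Qed.

Definition closed (A : algebra sg) (P : A -> Prop) :=
  forall o (x : 'I_(arity o) -> A), (forall k, P (x k)) -> P (interp A o x).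

Definition sub_alg (A : algebra sg) (P : A -> Prop) (cP : closed P) : algebra sg :=
  @Algebra sg {x : A | P x}
    (fun o x => exist P _ (cP o (fun k => sval (x k)) (fun k => svalP (x k)))).

Lemma eval_sub (A : algebra sg) (P : A -> Prop) (cP : closed P) (X : Type)
    (v : X -> sub_alg cP) t :
  sval (eval v t) = eval (fun x => sval (v x)) t.
Proof. exact: (@eval_hom (sub_alg cP) A sval). Qed.

Lemma sub_alg_in_variety (Sigma : term sg nat * term sg nat -> Prop) (A : algebra sg)
    (P : A -> Prop) (cP : closed P) :
  in_variety Sigma A -> in_variety Sigma (sub_alg cP).
Proof.
move=> VA e He v; apply: eq_sig_hprop => [x|]; first exact: proof_irrelevance.
by rewrite !eval_sub; apply: VA.
Qed.

(** Congruences of the subalgebra carved out by [P], kept as relations on all of [A]; the subtype is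
    formed only where modularity or the Kiss term is applied. *)
Definition cong_on (A : algebra sg) (P : A -> Prop) (th : A -> A -> Prop) :=
  [/\ (forall x, P x -> th x x),
      (forall x y, P x -> P y -> th x y -> th y x),
      (forall x y z, P x -> P y -> P z -> th x y -> th y z -> th x z) &
      (forall o (x y : 'I_(arity o) -> A), (forall k, P (x k)) -> (forall k, P (y k)) ->
         (forall k, th (x k) (y k)) -> th (interp A o x) (interp A o y))].

Lemma cong_on_sub_dom (A : algebra sg) (P Q : A -> Prop) th :
  (forall x, Q x -> P x) -> cong_on P th -> cong_on Q th.
Proof.
move=> QP [r s t c]; split.
- by move=> x /QP; apply: r.
- by move=> x y /QP ? /QP ?; apply: s.
- by move=> x y z /QP ? /QP ? /QP ?; apply: t.
- by move=> o x y Qx Qy; apply: c => k; apply: QP.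
Qed.

Definition sub_rel (A : algebra sg) (P : A -> Prop) (cP : closed P)
    (th : A -> A -> Prop) (x y : sub_alg cP) := th (sval x) (sval y).

Lemma cong_on_sub (A : algebra sg) (P : A -> Prop) (cP : closed P) th :
  cong_on P th -> is_congruence (sub_alg cP) (@sub_rel A P cP th).
Proof.
case=> r s t c; split.
- by case.
- by move=> [x Px] [y Py]; apply: s.
- by move=> [x Px] [y Py] [z Pz]; apply: t.
- by move=> o x y xy; apply: c => // k; apply: svalP.
Qed.

Lemma is_congruenceI (A : algebra sg) (al be : A -> A -> Prop) :
  is_congruence A al -> is_congruence A be ->
  is_congruence A (fun x y => al x y /\ be x y).
Proof.
move=> [r s t c] [r' s' t' c']; split=> //.
- by move=> x y [/s ? /s' ?].
- by move=> x y z [a b] [a' b']; split; [apply: t a a'|apply: t' b b'].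
- by move=> o x y xy; split; [apply: c|apply: c'] => k; case: (xy k).
Qed.

(** * Gumm's Shifting Lemma *)

(** The path [z], [x], [y], [u] puts ([z], [u]) into the join of [be] ∧ [ga] with [al], and the pair
    lies in [be]. By modularity it lies in the join of [be] ∧ [ga] with [al] ∧ [be], which is below
    [ga]. *)
Lemma shifting (Sigma : term sg nat * term sg nat -> Prop) (A : algebra sg)
    (al be ga : A -> A -> Prop) (x y z u : A) :
  congruence_modular_variety Sigma -> in_variety Sigma A ->
  is_congruence A al -> is_congruence A be -> is_congruence A ga ->
  (forall x y, al x y -> be x y -> ga x y) ->
  al x z -> al y u -> be x y -> be z u -> ga x y -> ga z u.
Proof.
move=> mod VA cal cbe cga sub xz yu xy zu gxy.
have [_ jn] := mod A VA (fun x y => be x y /\ ga x y) al be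
  (is_congruenceI cbe cga) cal cbe (fun x y h => proj1 h) z u.
apply: jn => // [|? ? []//|v w []]; last by auto.
split=> // de [_ s t _] h1 h2.
by apply: (t _ x); [apply/s/h2|apply: (t _ y); [apply: h1|apply: h2]].
Qed.

Lemma shifting_on (Sigma : term sg nat * term sg nat -> Prop) (A : algebra sg)
    (P : A -> Prop) (al be ga : A -> A -> Prop) (x y z u : A) :
  congruence_modular_variety Sigma -> in_variety Sigma A -> closed P ->
  cong_on P al -> cong_on P be -> cong_on P ga ->
  (forall x y, P x -> P y -> al x y -> be x y -> ga x y) ->
  P x -> P y -> P z -> P u ->
  al x z -> al y u -> be x y -> be z u -> ga x y -> ga z u.
Proof.
move=> mod VA cP cal cbe cga sub Px Py Pz Pu xz yu xy zu gxy.
apply: (@shifting Sigma (sub_alg cP) (@sub_rel A P cP al) (@sub_rel A P cP be)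
  (@sub_rel A P cP ga) (exist _ x Px) (exist _ y Py) (exist _ z Pz) (exist _ u Pu)) => //.
- exact: sub_alg_in_variety.
- exact: cong_on_sub.
- exact: cong_on_sub.
- exact: cong_on_sub.
- by move=> [v Pv] [w Pw]; apply: sub.
Qed.

(** * Transitive closures of relations compatible with one-argument changes *)

Section Closure.
Variables (A : algebra sg) (P : A -> Prop) (T : A -> A -> Prop).
Hypothesis cP : closed P.
Hypothesis Trefl : forall x, P x -> T x x.
Hypothesis Tsym : forall x y, T x y -> T y x.
Hypothesis Tunary : forall o (z : 'I_(arity o) -> A) k x y, (forall k, P (z k)) -> T x y ->
  T (interp A o (fun l => if l == k then x else z l))
    (interp A o (fun l => if l == k then y else z l)).

Lemma clos_trans_cong_on : cong_on P (clos_trans A T).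
Proof.
split.
- by move=> x Px; apply/t_step/Trefl.
- move=> x y _ _; elim=> [u v /Tsym uv|u v w _ vu _ wv]; first exact: t_step.
  exact: t_trans wv vu.
- by move=> x y z _ _ _; apply: t_trans.
move=> o x y Px Py xy.
(* [h j] has its first [j] arguments already replaced, so passing to [h j.+1] changes a single
   argument, and [Tunary] applies along the chain for that argument. *)
pose h j (k : 'I_(arity o)) := if k < j then y k else x k.
have Ph j k : P (h j k) by rewrite /h; case: ifP.
suff H j : clos_trans A T (interp A o x) (interp A o (h j)).
  have -> : y = h (arity o); last exact: H.
  by apply: functional_extensionality => k; rewrite /h ltn_ord.
elim: j => [|j IH].
  have -> : h 0 = x by apply: functional_extensionality.
  exact/t_step/Trefl/cP.
have [jn|nj] := ltnP j (arity o); last first.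
  suff -> : h j.+1 = h j by [].
  apply: functional_extensionality => k.
  by rewrite /h !(leq_trans (ltn_ord k)) // leqW.
apply: t_trans IH _; pose k0 := Ordinal jn.
have -> : h j = fun l => if l == k0 then x k0 else h j l.
  apply: functional_extensionality => l; case: eqP => [->|//].
  by rewrite /h /= ltnn.
have -> : h j.+1 = fun l => if l == k0 then y k0 else h j l.
  apply: functional_extensionality => l; rewrite /h ltnS leq_eqVlt.
  case: (eqVneq l k0) => [->|]; first by rewrite /= eqxx.
  by rewrite -(inj_eq val_inj) /= => /negbTE ->.
elim: (xy k0) => [u v uv|u v w _ uv _ vw]; first exact/t_step/Tunary.
exact: t_trans uv vw.
Qed.

End Closure.
End Evaluation.

(** * Higher dimensional congruences without dependent types *)

Section Flat.
Variables (T : Type) (I : finType).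
Implicit Types (f : {ffun I -> bool}) (X Y Z W : cube T I).

Definition upd f (i : I) (j : bool) : {ffun I -> bool} :=
  [ffun k => if k == i then j else f k].

Lemma upd_same f i j : upd f i j i = j.
Proof. by rewrite ffunE eqxx. Qed.

Lemma upd_diff f i j k : k != i -> upd f i j k = f k.
Proof. by rewrite ffunE => /negbTE ->. Qed.

Lemma upd_upd f i j j' : upd (upd f i j) i j' = upd f i j'.
Proof. by apply/ffunP => k; rewrite !ffunE; case: eqP. Qed.

Lemma updC f i d j j' : i != d -> upd (upd f i j) d j' = upd (upd f d j') i j.
Proof.
move=> id; apply/ffunP => k; rewrite !ffunE.
by case: (eqVneq k d) => // ->; rewrite eq_sym (negbTE id).
Qed.

Lemma upd_id f i j : f i = j -> upd f i j = f.
Proof. by move=> <-; apply/ffunP => k; rewrite ffunE; case: eqP => // ->. Qed.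

(* [flat] is [refl], and [joinf i j Z W] is the cube whose two faces in direction [i]
   are the [j]-faces of [Z] and [W], with a face stored as any cube that has it. *)
Definition flat i j X : cube T I := [ffun f => X (upd f i j)].

Definition joinf i j Z W : cube T I :=
  [ffun f : {ffun I -> bool} => if f i then W (upd f i j) else Z (upd f i j)].

Lemma ext_restr i j f : ext j (restr i f) = upd f i j.
Proof.
apply/ffunP => k; rewrite !ffunE; case: insubP => [k' ki <-|].
  by rewrite ffunE (negbTE (valP k')).
by rewrite negbK => ->.
Qed.

Lemma restr_ext i j (h : {ffun {k : I | k != i} -> bool}) : restr i (ext j h) = h.
Proof. by apply/ffunP => k; rewrite !ffunE valK. Qed.

Lemma ext_at i j (h : {ffun {k : I | k != i} -> bool}) : ext j h i = j.
Proof. by rewrite ffunE insubF ?eqxx. Qed.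

Lemma glue_face i j Z W : glue (face i j Z) (face i j W) = joinf i j Z W.
Proof. by apply/ffunP => f; rewrite !ffunE ext_restr. Qed.

Lemma face_glue i j (z w : cube T {k : I | k != i}) :
  face i j (glue z w) = if j then w else z.
Proof. by apply/ffunP => h; rewrite ffunE /glue ffunE ext_at restr_ext; case: j. Qed.

Lemma glueK i X : glue (face i false X) (face i true X) = X.
Proof.
by apply/ffunP => f; rewrite !ffunE !ext_restr; case: ifP => fi; rewrite upd_id.
Qed.

Lemma reflE i j X : refl i j X = flat i j X.
Proof. by apply/ffunP => f; rewrite !ffunE ext_restr if_same. Qed.

Lemma joinf_id i j X : joinf i j X X = flat i j X.
Proof. by apply/ffunP => f; rewrite !ffunE if_same. Qed.

Lemma joinf_flatl i X : joinf i true (flat i false X) X = X.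
Proof. by apply/ffunP => f; rewrite !ffunE !upd_upd; case: ifP => fi; rewrite upd_id. Qed.

Lemma joinf_flatr i X : joinf i false X (flat i true X) = X.
Proof. by apply/ffunP => f; rewrite !ffunE !upd_upd; case: ifP => fi; rewrite upd_id. Qed.

Lemma flat_flat i j j' X : flat i j (flat i j' X) = flat i j' X.
Proof. by apply/ffunP => f; rewrite !ffunE upd_upd. Qed.

Lemma flat_joinf i j j' Z W : flat i j' (joinf i j Z W) = flat i j (if j' then W else Z).
Proof. by apply/ffunP => f; rewrite !ffunE eqxx upd_upd; case: j'. Qed.

Lemma flat_joinfC i d j j' Z W : i != d ->
  flat i j' (joinf d j Z W) = joinf d j (flat i j' Z) (flat i j' W).
Proof.
move=> id; apply/ffunP => f; rewrite !ffunE eq_sym (negbTE id).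
by rewrite !(updC _ _ _ id).
Qed.

Lemma eq_joinf i j Z Z' W W' : flat i j Z = flat i j Z' -> flat i j W = flat i j W' ->
  joinf i j Z W = joinf i j Z' W'.
Proof.
move=> /ffunP zz /ffunP ww; apply/ffunP => f.
by have := zz f; have := ww f; rewrite !ffunE => -> ->.
Qed.

End Flat.

(** * A higher dimensional congruence as a congruence on its faces *)

Section HigherCongruence.
Variables (sg : signature) (A : algebra sg) (I : finType).
Implicit Types (X Y Z W : cube A I).

Lemma flat_interp i j o (x : 'I_(arity o) -> cube_alg A I) :
  flat i j (interp (cube_alg A I) o x) = interp (cube_alg A I) o (fun k => flat i j (x k)).
Proof.
apply/ffunP => f; rewrite !ffunE; congr interp.
by apply: functional_extensionality => k; rewrite ffunE.
Qed.

Lemma joinf_interp i j o (x y : 'I_(arity o) -> cube_alg A I) :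
  joinf i j (interp (cube_alg A I) o x) (interp (cube_alg A I) o y) =
  interp (cube_alg A I) o (fun k => joinf i j (x k) (y k)).
Proof.
apply/ffunP => f; rewrite !ffunE.
by case: ifP => fi; congr interp; apply: functional_extensionality => k; rewrite ffunE fi.
Qed.

Variable R : cube A I -> Prop.
Hypothesis hR : higher_congruence R.

Lemma hc_closed : closed (A := cube_alg A I) R.
Proof. by case: hR. Qed.

Lemma hc_flat i j X : R X -> R (flat i j X).
Proof. by case: hR => _ h _ _ RX; rewrite -reflE; apply: h. Qed.

Lemma hc_joinf_sym i j Z W : R (joinf i j Z W) -> R (joinf i j W Z).
Proof.
case: hR => _ _ h _ RX; suff <- : sym i (joinf i j Z W) = joinf i j W Z by apply: h.
by rewrite -!glue_face /sym !face_glue.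
Qed.

Lemma hc_joinf_trans i j Z W Y :
  R (joinf i j Z W) -> R (joinf i j W Y) -> R (joinf i j Z Y).
Proof.
case: hR => _ _ _ h ZW WY.
have [||g [Rg [g0 g1]]] := h i (face i j Z) (face i j W) (face i j Y).
- by exists (joinf i j Z W); rewrite -glue_face !face_glue glue_face.
- by exists (joinf i j W Y); rewrite -glue_face !face_glue glue_face.
by rewrite -glue_face -g0 -g1 glueK.
Qed.

Lemma closed_flat i j : closed (A := cube_alg A I) (fun X => R (flat i j X)).
Proof. by move=> o x Rx; rewrite flat_interp; apply: hc_closed. Qed.

(** In each direction [R] acts as an ordinary congruence on the algebra of its faces; a cube stands
    here for its [j]-face only. *)
Lemma joinf_cong_on i j :
  cong_on (A := cube_alg A I) (fun X => R (flat i j X)) (fun Z W => R (joinf i j Z W)).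
Proof.
split.
- by move=> X RX; rewrite joinf_id.
- by move=> Z W _ _; apply: hc_joinf_sym.
- by move=> Z W Y _ _ _; apply: hc_joinf_trans.
- by move=> o x y _ _ xy; rewrite joinf_interp; apply: hc_closed.
Qed.

End HigherCongruence.

Lemma agree_cong_on (sg : signature) (A : algebra sg) (I : finType) P
    (S : {ffun I -> bool} -> Prop) :
  cong_on (A := cube_alg A I) P (fun Z W : cube A I => forall f, S f -> Z f = W f).
Proof.
split=> // [Z W _ _ ZW f Sf|Z W Y _ _ _ ZW WY f Sf|o x y _ _ xy f Sf].
- by rewrite ZW.
- by rewrite ZW ?WY.
- by rewrite !ffunE; congr interp; apply: functional_extensionality => k; apply: xy.
Qed.

(* Shifting along direction [i]: the change from [E] to [E'] on [S] stays inside one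
   class of [R] seen as a congruence on its faces, so the same change may be made to [X]. *)
Lemma corner_shift (sg : signature) (Sigma : term sg nat * term sg nat -> Prop)
    (A : algebra sg) (I : finType) (R : cube A I -> Prop) (i : I)
    (S : pred {ffun I -> bool}) (X Y E E' : cube A I) :
  congruence_modular_variety Sigma -> in_variety Sigma A -> higher_congruence R ->
  (forall f, S f -> f i) ->
  R X -> R E -> R E' -> R (flat i true Y) ->
  (forall f, ~~ S f -> X f = Y f) -> (forall f, ~~ S f -> E f = E' f) ->
  (forall f, S f -> E f = X f) -> (forall f, S f -> E' f = Y f) -> R Y.
Proof.
move=> mod VA hR Si RX RE RE' RY XY EE' EX E'Y.
have agree0 (U V : cube A I) : (forall f, ~~ S f -> U f = V f) ->
    flat i false U = flat i false V.
  move=> UV; apply/ffunP => f; rewrite !ffunE UV //.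
  by apply/negP => /Si; rewrite upd_same.
(* [E] and [E'] have the same 0-face in direction [i]; transitivity through it relates their
   1-faces. *)
have REE' : R (joinf i true E E').
  apply: (hc_joinf_trans hR (W := flat i false E)).
    by apply: (hc_joinf_sym hR); rewrite joinf_flatl.
  by rewrite (agree0 _ _ EE') joinf_flatl.
suff RXY : R (joinf i true X Y).
  rewrite -(joinf_flatl i Y) -(agree0 _ _ XY).
  by apply: hc_joinf_trans RXY => //; rewrite joinf_flatl.
(* In the parallelogram [E], [E'], [X], [Y] one pair of sides agrees on [S] and the other off [S];
   cubes agreeing on both are equal. *)
apply: (@shifting_on sg Sigma (cube_alg A I) (fun Z : cube A I => R (flat i true Z))
  (fun Z W : cube A I => forall f, S f -> Z f = W f)
  (fun Z W : cube A I => forall f, ~~ S f -> Z f = W f)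
  (fun Z W : cube A I => R (joinf i true Z W)) E E') => //.
- exact: cube_alg_in_variety.
- exact: closed_flat.
- exact: agree_cong_on.
- exact: agree_cong_on.
- exact: joinf_cong_on.
- move=> Z W RZ _ on off; suff <- : Z = W by rewrite joinf_id.
  by apply/ffunP => f; case: (boolP (S f)); [apply: on|apply: off].
- exact: hc_flat.
- exact: hc_flat.
- exact: hc_flat.
Qed.

(** * Completing along one more direction *)

Section Step.
Variables (sg : signature) (Sigma : term sg nat * term sg nat -> Prop).
Variables (A : algebra sg) (I : finType) (R : cube A I -> Prop) (i d : I).
Variable S : pred {ffun I -> bool}.
Hypothesis mod : congruence_modular_variety Sigma.
Hypothesis VA : in_variety Sigma A.
Hypothesis hR : higher_congruence R.
Hypothesis ineqd : i != d.
Hypothesis Si : forall f, S f -> f i.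
Hypothesis Sd : forall f j, S (upd f d j) = S f.
Implicit Types (X Y Z W : cube A I).

Local Notation D := (cube_alg A I).
Local Notation C := (fun Z : cube A I => R (flat d false Z)).
Local Notation be := (fun Z W : cube A I => R (joinf d false Z W)).

(** Of the cube formed by the two faces, only its 1-face in direction [i] must come from [R]. This
    is weaker than [be], and the two faces of the given cube satisfy it. *)
Definition rho Z W := R (flat i true (joinf d false Z W)).

Lemma rho_cong_on : cong_on (A := D) C rho.
Proof.
rewrite /rho; split.
- by move=> Z CZ; rewrite joinf_id; apply: hc_flat.
- by move=> Z W _ _; rewrite !flat_joinfC //; apply: hc_joinf_sym.
- by move=> Z W Y _ _ _; rewrite !flat_joinfC //; apply: hc_joinf_trans.
- by move=> o x y _ _ xy; rewrite joinf_interp flat_interp; apply: hc_closed.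
Qed.

Lemma be_rho Z W : be Z W -> rho Z W.
Proof. exact: (hc_flat hR). Qed.

(* [rho] itself as a subalgebra of the square of [C]: a pair of faces is stored as the
   cube that they form, so that the pairs in [be] are exactly the cubes in [R]. *)
Definition in_rho Z := [/\ R (flat d false Z), R (flat d true Z) & R (flat i true Z)].

Lemma in_rho_joinf Z W : C Z -> C W -> rho Z W -> in_rho (joinf d false Z W).
Proof. by move=> CZ CW; split; rewrite ?flat_joinf. Qed.

Lemma in_rho_flat Z : C Z -> in_rho (flat d false Z).
Proof. by move=> CZ; split; rewrite ?flat_flat //; apply: hc_flat. Qed.

Lemma closed_in_rho : closed (A := D) in_rho.
Proof.
by move=> o x Bx; split; rewrite flat_interp; apply: (hc_closed hR) => k; case: (Bx k).
Qed.

(** A change on [S] alone that also occurs between two cubes of [R] agreeing off [S]: the data that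
    [corner_shift] consumes. *)
Definition swap Z W := (forall f, ~~ S f -> Z f = W f) /\
  exists E E' : cube A I, [/\ R E, R E', forall f, ~~ S f -> E f = E' f,
    forall f, S f -> E f = Z f & forall f, S f -> E' f = W f].

Definition facewise Z W := R (joinf d false Z W) /\ R (joinf d true Z W).

Lemma swap_refl Z : in_rho Z -> swap Z Z.
Proof.
case=> _ _ RZ; split=> //; exists (flat i true Z), (flat i true Z).
by split=> // f /Si fi; rewrite ffunE upd_id.
Qed.

Lemma swap_sym Z W : swap Z W -> swap W Z.
Proof.
case=> ZW [E [E' [RE RE' EE' EZ EW]]]; split=> [f /ZW //|].
by exists E', E; split=> // f /EE'.
Qed.

Lemma swap_interp o (x y : 'I_(arity o) -> D) :
  (forall k, swap (x k) (y k)) -> swap (interp D o x) (interp D o y).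
Proof.
move=> xy; split.
  have [_ _ _ c] := @agree_cong_on sg A I (fun _ => True) (fun f => ~~ S f).
  by apply: c => // k; case: (xy k).
have /fin_all_exists [E HE] k := proj2 (xy k).
have /fin_all_exists [E' HE'] k := HE k.
exists (interp D o E), (interp D o E').
split; try by apply: (hc_closed hR) => k; case: (HE' k).
all: by move=> f Sf; rewrite !ffunE; congr interp; apply: functional_extensionality => k;
  case: (HE' k) => _ _ h1 h2 h3; first [exact: h1|exact: h2|exact: h3].
Qed.

Lemma facewise_refl Z : in_rho Z -> facewise Z Z.
Proof. by case=> Z0 Z1 _; split; rewrite joinf_id. Qed.

Lemma facewise_sym Z W : facewise Z W -> facewise W Z.
Proof. by case=> Z0 Z1; split; apply: hc_joinf_sym. Qed.

Lemma facewise_interp o (x y : 'I_(arity o) -> D) :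
  (forall k, facewise (x k) (y k)) -> facewise (interp D o x) (interp D o y).
Proof.
by move=> xy; split; rewrite joinf_interp; apply: (hc_closed hR) => k; case: (xy k).
Qed.

Definition link Z W := [/\ in_rho Z, in_rho W & swap Z W \/ facewise Z W].
(** A congruence on the algebra of [rho]-pairs: small enough to preserve membership in [R], yet
    containing all pairs of elements with equal second entries and [be]-related first entries. *)
Definition Lam := clos_trans D link.

Lemma Lam_cong_on : cong_on (A := D) in_rho Lam.
Proof.
apply: clos_trans_cong_on => //.
- exact: closed_in_rho.
- by move=> Z BZ; split=> //; left; apply: swap_refl.
- by move=> Z W [BZ BW [/swap_sym|/facewise_sym]]; split; auto.
- move=> o z k X Y Bz [BX BY XY]; split.
  + by apply: closed_in_rho => l; case: eqP.
  + by apply: closed_in_rho => l; case: eqP.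
  case: XY => XY; [left; apply: swap_interp|right; apply: facewise_interp] => l;
    case: eqP => // _; [exact: swap_refl|exact: facewise_refl].
Qed.

Lemma Lam_R Z W : Lam Z W -> R Z -> R W.
Proof.
elim=> [{}Z {}W [BZ BW ZW] RZ|X Y U _ XY _ YU /XY /YU //].
have [_ _ RW] := BW.
case: ZW => [[ZW [E [E' [RE RE' EE' EZ EW]]]]|[ZW0 ZW1]].
  exact: (corner_shift mod VA hR Si RZ RE RE' RW).
have tofalse : joinf d true Z W = joinf d false (flat d true Z) (flat d true W).
  by apply/ffunP => f; rewrite !ffunE !upd_upd.
rewrite -(joinf_flatr d W).
apply: (hc_joinf_trans hR (hc_joinf_sym hR ZW0)).
apply: (hc_joinf_trans hR (W := flat d true Z)); first by rewrite joinf_flatr.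
by rewrite -tofalse.
Qed.

(** [flat d false Z] is the pair with both entries the 0-face of [Z], so this is [Lam] pulled back
    along the diagonal. *)
Definition alph Z W := Lam (flat d false Z) (flat d false W).

Lemma alph_cong_on : cong_on (A := D) C alph.
Proof.
have [r s t c] := Lam_cong_on; rewrite /alph; split.
- by move=> Z /in_rho_flat; apply: r.
- by move=> Z W /in_rho_flat BZ /in_rho_flat BW; apply: s.
- by move=> Z W Y /in_rho_flat BZ /in_rho_flat BW /in_rho_flat BY; apply: t.
- by move=> o x y Cx Cy xy; rewrite !flat_interp; apply: c => // k; apply: in_rho_flat.
Qed.

Lemma alph_agree Z W : C Z -> C W -> (forall f, ~~ S f -> Z f = W f) -> alph Z W.
Proof.
move=> CZ CW ZW; apply: t_step; split; try exact: in_rho_flat.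
have ZW' f : ~~ S f -> flat d false Z f = flat d false W f.
  by move=> Sf; rewrite !ffunE ZW // Sd.
by left; split=> //; exists (flat d false Z), (flat d false W).
Qed.

Lemma alph_be Z W : C Z -> C W -> be Z W -> alph Z W.
Proof.
move=> CZ CW ZW; apply: t_step; split; try exact: in_rho_flat.
have E j : joinf d j (flat d false Z) (flat d false W) = joinf d false Z W.
  by apply/ffunP => f; rewrite !ffunE !upd_upd.
by right; split; rewrite E.
Qed.

(** Shifting among [rho]-pairs: ([X], [Z]) and ([Y], [W]) move to ([Z], [Z]) and ([Z], [W]) without
    changing second entries, while first entries stay [be]-related. So the last two are
    [Lam]-related, and the diagonal one lies in [R]. *)
Lemma be_shift X Y Z W : C X -> C Y -> C Z -> C W -> rho X Z -> rho Y W ->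
  Lam (joinf d false X Z) (joinf d false Y W) -> be X Y -> be Z W.
Proof.
move=> CX CY CZ CW XZ YW L XY.
have [_ rs rt _] := rho_cong_on.
have ZW : rho Z W.
  by apply: (rt _ X) => //; [apply: rs|apply: (rt _ Y) => //; apply: be_rho].
suff : Lam (flat d false Z) (joinf d false Z W) by move=> /Lam_R; apply.
apply: (@shifting_on sg Sigma D in_rho
  (fun P Q : cube A I => forall f : {ffun I -> bool}, f d -> P f = Q f)
  (fun P Q : cube A I => R (joinf d false P Q)) Lam
  (joinf d false X Z) (joinf d false Y W)) => //.
- exact: cube_alg_in_variety.
- exact: closed_in_rho.
- exact: agree_cong_on.
- by apply: cong_on_sub_dom (joinf_cong_on hR d false) => U [].
- exact: Lam_cong_on.
- move=> P Q BP BQ PQ1 PQ0; apply: t_step; split=> //; right; split=> //.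
  suff -> : joinf d true P Q = flat d true P by case: BP.
  by apply/ffunP => f; rewrite !ffunE; case: ifP => // fd; rewrite PQ1 ?upd_same.
- exact: in_rho_joinf.
- exact: in_rho_joinf.
- exact: in_rho_flat.
- exact: in_rho_joinf.
- by move=> f fd; rewrite !ffunE fd.
- by move=> f fd; rewrite !ffunE fd.
- suff -> : joinf d false (joinf d false X Z) (joinf d false Y W) = joinf d false X Y by [].
  by apply: eq_joinf; rewrite flat_joinf.
- suff -> : joinf d false (flat d false Z) (joinf d false Z W) = flat d false Z by [].
  by rewrite -joinf_id; apply: eq_joinf; rewrite ?flat_joinf ?flat_flat.
Qed.

Let cC : closed (A := D) C := closed_flat hR (i := d) (j := false).
Let Calg := sub_alg cC.
Local Notation on_C := (@sub_rel sg D C cC).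

Lemma alph_rho_TC : @TC_condition sg Calg (on_C alph) (on_C rho) (on_C be).
Proof.
move=> g Mg.
have [r s t c] := Lam_cong_on.
have [rr rs rt rc] := rho_cong_on.
pose v a b : cube A I := sval (g (pt2 a b)).
have Cv a b : C (v a b) := svalP (g (pt2 a b)).
suff [XZ YW L] : [/\ rho (v false false) (v false true), rho (v true false) (v true true) &
    Lam (joinf d false (v false false) (v false true))
        (joinf d false (v true false) (v true true))].
  by split; [apply: be_shift L|move=> RX; apply: Lam_R L _].
rewrite /v {v Cv}.
(* Squares whose two [rho]-lines are [Lam]-related form a subalgebra containing the generators: an
   [alph]-generator has two diagonal lines, a [rho]-generator repeats one line. *)
pose Q (h : cube Calg 'I_2) :=
  let w a b : cube A I := sval (h (pt2 a b)) in
  [/\ rho (w false false) (w false true), rho (w true false) (w true true) &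
    Lam (joinf d false (w false false) (w false true))
        (joinf d false (w true false) (w true true))].
apply: (Mg Q).
  move=> o gs Qgs; rewrite /Q.
  have E a b : sval ([ffun f => interp Calg o (fun k => gs k f)] (pt2 a b)) =
      interp D o (fun k => sval (gs k (pt2 a b))) by rewrite ffunE.
  cbv zeta; rewrite !E; split.
  - by apply: rc => k; [exact: (svalP (gs k _))|exact: (svalP (gs k _))|case: (Qgs k)].
  - by apply: rc => k; [exact: (svalP (gs k _))|exact: (svalP (gs k _))|case: (Qgs k)].
  - rewrite !joinf_interp; apply: c => k; case: (Qgs k) => // q1 q2 _;
      by apply: in_rho_joinf => //; exact: (svalP (gs k _)).
move=> k [x Cx] [y Cy]; rewrite /Q /two /sub_rel /= !ffunE.
case: k => [[|[|//]] k2] /= xy.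
  by split; rewrite ?joinf_id //; apply: rr.
split=> //; apply: r; exact: in_rho_joinf.
Qed.

(* The squares [(g', g, g', flat d true g)] and [(g', g, g', g)] of [C] have three common
   vertices, so the Kiss term sends both into one class of the commutator, hence of [be]. *)
Lemma kiss_step (q2 : term sg 'I_4) (g g' : cube A I) :
  kiss_term Sigma q2 -> R g' -> (forall f, ~~ S f -> g' f = g f) ->
  R (flat d false g) -> R (flat d true g) -> R (flat i true g) ->
  R [ffun f : {ffun I -> bool} =>
      if f d then eval (vec4 (g' (upd f d false)) (g (upd f d false)) (g' f) (g f)) q2
      else g f].
Proof.
move=> [qid qcom] Rg' g'g Cg Rg1 Rgi.
have VC : in_variety Sigma Calg by apply/sub_alg_in_variety/cube_alg_in_variety.
have Cg' : C g' by apply: hc_flat.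
have Ch : C (flat d true g) by rewrite flat_flat.
have Ch' : C (flat d true g') by rewrite flat_flat; apply: hc_flat.
pose a : Calg := exist _ g' Cg'; pose b : Calg := exist _ g Cg.
pose c : Calg := exist _ _ Ch'; pose e : Calg := exist _ _ Ch.
have cbe : is_congruence Calg (on_C be) by apply/cong_on_sub/joinf_cong_on.
have cal : is_congruence Calg (on_C alph) by apply/cong_on_sub/alph_cong_on.
have crho : is_congruence Calg (on_C rho) by apply/cong_on_sub/rho_cong_on.
have [br bs bt _] := cbe; have [_ _ alt _] := cal; have [rr _ _ _] := crho.
have ab : on_C alph a b by apply: alph_agree.
have bac : on_C be a c by rewrite /sub_rel /= joinf_flatr.
have ac : on_C alph a c by apply: alph_be.
have ce : on_C alph c e.
  by apply: alph_agree => // f Sf; rewrite !ffunE g'g // Sd.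
have rbe : on_C rho b e by rewrite /sub_rel /rho /= joinf_flatr.
(* The [alph]-line from [a] to [e] goes through [c]: [a] and [c] are [be]-related because [g'] lies
   in [R], and [c] agrees with [e] off [S]. *)
have K := qcom Calg VC _ _ cal crho a b a e b
  (And4 ab (alt _ _ _ ac ce) (rr a) rbe) (And4 ab ab (rr a) (rr b)) _ cbe alph_rho_TC.
rewrite (proj2 (qid Calg VC a b)) in K.
have K' : on_C be (eval (vec4 a b a e) q2) (eval (vec4 a b c e) q2).
  by apply: eval_cong => // -[[|[|[|[|//]]]]].
have {K K'} := bt _ _ _ (bs _ _ K) K'.
(* Being [be]-related to [b] means forming, with the 0-face of [g], a cube of [R]. This cube is the
   one sought, since [c] and [e] store the 1-faces of [g'] and [g] as 0-faces. *)
have -> : on_C be b (eval (vec4 a b c e) q2) =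
    be g (eval (fun k => sval (vec4 a b c e k)) q2 : D).
  by rewrite /sub_rel -(@eval_sub sg D C cC).
congr (R _); apply/ffunP => f; rewrite !ffunE eval_cube.
case: ifP => fd; last by rewrite upd_id.
by apply: eq_eval => -[[|[|[|[|//]]]] ? //=]; rewrite /vec4 /= ?ffunE ?upd_upd ?upd_id.
Qed.

End Step.

(** * Faces of Delta *)

Section DeltaFaces.
Variables (sg : signature) (A : algebra sg).

Lemma Delta_higher_congruence (I : finType) (th : I -> A -> A -> Prop) :
  higher_congruence (Delta th).
Proof.
split.
- move=> o gs Dg R hR MR; case: (hR) => c _ _ _.
  by apply: c => k; apply: Dg.
- by move=> g i j Dg R hR MR; case: (hR) => _ r _ _; apply/r/(Dg R hR MR).
- by move=> g i Dg R hR MR; case: (hR) => _ _ s _; apply/s/(Dg R hR MR).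
move=> i z e w [g [Dg [g0 g1]]] [h [Dh [h0 h1]]].
(* Two opposite faces determine a cube, so one witness serves every [R] in the intersection. *)
exists (glue z w); rewrite !face_glue; split=> // R hR MR.
case: (hR) => _ _ _ t.
have [||k [Rk [<- <-]]] := t i z e w; last by rewrite glueK.
- by exists g; split; [exact: (Dg R hR MR)|].
- by exists h; split; [exact: (Dh R hR MR)|].
Qed.

Definition lift_cube (I : finType) (i : I) (h : cube A {k : I | k != i}) : cube A I :=
  [ffun f => h (restr i f)].

Lemma restr_upd (I : finType) (i : I) (k : {k : I | k != i}) j f :
  restr i (upd f (val k) j) = upd (restr i f) k j.
Proof. by apply/ffunP => l; rewrite !ffunE (inj_eq val_inj). Qed.

Lemma lift_joinf (I : finType) (i : I) (k : {k : I | k != i}) j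
    (z w : cube A {k : I | k != i}) :
  lift_cube (joinf k j z w) = joinf (val k) j (lift_cube z) (lift_cube w).
Proof. by apply/ffunP => f; rewrite ffunE /joinf !ffunE !restr_upd. Qed.

Lemma lift_higher_congruence (I : finType) (i : I) (R : cube A I -> Prop) :
  higher_congruence R -> higher_congruence (fun h => R (@lift_cube I i h)).
Proof.
move=> hR; split.
- move=> o gs Rgs; have [c _ _ _] := hR.
  suff -> : lift_cube [ffun f => interp A o (fun k => gs k f)] =
      [ffun f => interp A o (fun k => lift_cube (gs k) f)] by apply: c.
  apply/ffunP => f; rewrite !ffunE; congr interp.
  by apply: functional_extensionality => k; rewrite ffunE.
- move=> g k j Rg; rewrite reflE -joinf_id lift_joinf joinf_id.
  exact: hc_flat.
- move=> g k Rg.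
  have -> : sym k g = joinf k false (flat k true g) g.
    by rewrite -{1}(joinf_flatr k g) -!glue_face /sym !face_glue.
  rewrite lift_joinf; apply: (hc_joinf_sym hR).
  by rewrite -lift_joinf joinf_flatr.
move=> k z e w [g [Rg [g0 g1]]] [h [Rh [h0 h1]]].
exists (glue z w); rewrite !face_glue; split=> //.
have gf (X : cube A {k : I | k != i}) j j' : face k j (flat k j' X) = face k j' X.
  by rewrite -reflE face_glue; case: j.
have jo (X Y : cube A {k : I | k != i}) j j' :
    joinf k false (flat k j X) (flat k j' Y) = glue (face k j X) (face k j' Y).
  by rewrite -glue_face !gf.
have -> : glue z w = joinf k false (flat k false g) (flat k true h).
  by rewrite jo g0 h1.
rewrite lift_joinf.
apply: (hc_joinf_trans hR (W := lift_cube (flat k true g))).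
  by rewrite -lift_joinf jo glueK.
suff -> : flat k true g = flat k false h by rewrite -lift_joinf jo glueK.
by rewrite -!reflE /refl g1 h0.
Qed.

(** The cubes whose constant extension in direction [i] lies in [Delta th] form a higher dimensional
    congruence, and it contains the generators of the lower dimensional [Delta]. *)
Lemma Delta_face (I : finType) (th : I -> A -> A -> Prop) (i : I) j (g : cube A I) :
  Delta (fun k : {k : I | k != i} => th (val k)) (face i j g) -> Delta th (flat i j g).
Proof.
move=> Dg; rewrite -reflE.
have -> : refl i j g = lift_cube (face i j g).
  by apply/ffunP => f; rewrite !ffunE if_same.
have hD := Delta_higher_congruence th.
apply: (Dg (fun h => Delta th (lift_cube h))); first exact: lift_higher_congruence.
move=> h Mh; apply: (Mh (fun h => Delta th (lift_cube h))).
  by case: (lift_higher_congruence i hD).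
move=> k x y xy R hR; apply; move=> P cP gen.
suff -> : lift_cube (cube_at k x y) = cube_at (val k) x y by apply: gen.
by apply/ffunP => f; rewrite !ffunE.
Qed.

End DeltaFaces.

(** * Partial completions *)

Section PartialHat.
Variables (sg : signature) (A : algebra sg) (q2 : term sg 'I_4) (n : nat).
Implicit Types (g : cube A 'I_n) (f : {ffun 'I_n -> bool}).

Lemma eval_qtermS (v : nat -> A) m : 1 < m ->
  eval v (qterm q2 m.+1) =
  eval (vec4 (eval v (qterm q2 m)) (v (2 ^ m).-1)
             (eval (fun k => v (2 ^ m + k)) (qterm q2 m)) (v (2 ^ m.+1).-1)) q2.
Proof.
move=> m1; rewrite /= ltnNge m1 /= eval_subst; apply: eq_eval => -[[|[|[|[|//]]]] ?] //=.
  by rewrite eval_subst.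
by rewrite expnS.
Qed.

Lemma eval_qterm2 (v : nat -> A) : eval v (qterm q2 2) = eval (vec4 (v 0) (v 1) (v 2) (v 3)) q2.
Proof. by rewrite /= eval_subst; apply: eq_eval => -[[|[|[|[|//]]]] ?]. Qed.

Lemma eq_eval_qterm (v w : nat -> A) m : 1 < m ->
  (forall k, k < 2 ^ m -> v k = w k) -> eval v (qterm q2 m) = eval w (qterm q2 m).
Proof.
elim: m v w => [//|m IH] v w; rewrite ltnS leq_eqVlt => /orP[/eqP <-|m1] vw.
  by rewrite !eval_qterm2 !vw.
have lt2 : 0 < 2 ^ m by rewrite expn_gt0.
have sub k : k < 2 ^ m -> k < 2 ^ m.+1 by move/leq_trans; apply; rewrite leq_exp2l.
rewrite !eval_qtermS //; congr (eval (vec4 _ _ _ _) _).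
- by apply: IH => // k /sub /vw.
- by apply: vw; apply: sub; rewrite prednK.
- by apply: IH => // k km; apply: vw; rewrite expnS mul2n -addnn ltn_add2l.
- by apply: vw; rewrite prednK // expn_gt0.
Qed.

(** Enumerates, for [k] below [2 ^ m], the vertices of the face through [f] spanned by the first [m]
    directions. *)
Definition colex_upto m k f : {ffun 'I_n -> bool} :=
  [ffun i : 'I_n => if i < m then odd (k %/ 2 ^ i) else f i].

Definition ones_upto m : pred {ffun 'I_n -> bool} :=
  fun f => [forall i : 'I_n, (i < m) ==> f i].

(** The stage g_m, from [m = 2] on. Since [qterm] at 1 is again [q2] and not a projection, the stage
    g_1 is represented by [flat i false g]. *)
Definition hat_upto m g : cube A 'I_n :=
  [ffun f => if ones_upto m f then eval (fun k => g (colex_upto m k f)) (qterm q2 m)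
             else g f].

Lemma ones_uptoP m f : reflect (forall i : 'I_n, i < m -> f i) (ones_upto m f).
Proof. by apply: (iffP forallP) => h i; apply/implyP/h. Qed.

Lemma ones_uptoS (d : 'I_n) f : ones_upto d.+1 f = ones_upto d f && f d.
Proof.
apply/ones_uptoP/andP => [h|[/ones_uptoP h fd] i].
  by split; [apply/ones_uptoP => i id; apply: h; apply: leqW|apply: h].
by rewrite ltnS leq_eqVlt => /orP[/eqP /val_inj -> //|]; apply: h.
Qed.

Lemma ones_upto_upd (d : 'I_n) f j : ones_upto d (upd f d j) = ones_upto d f.
Proof.
apply/ones_uptoP/ones_uptoP => h i id; have := h i id;
  by rewrite upd_diff // -(inj_eq val_inj) neq_ltn id.
Qed.

Lemma hat_upto_all g : hat_upto n g = hat q2 g.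
Proof.
apply/ffunP => f; rewrite !ffunE.
have -> : ones_upto n f = (f == [ffun => true]).
  apply/ones_uptoP/eqP => [h|-> i _]; last by rewrite ffunE.
  by apply/ffunP => i; rewrite ffunE h.
case: eqP => // _; apply: eq_eval => k; congr (g _).
by apply/ffunP => i; rewrite !ffunE ltn_ord.
Qed.

Lemma odd_pow2_pred m i : i < m -> odd ((2 ^ m).-1 %/ 2 ^ i).
Proof.
(* Dividing by [2 ^ i] leaves the quotient [(2 ^ (m - i)).-1], which is odd as [i < m]. *)
move=> im; have -> : (2 ^ m).-1 = (2 ^ (m - i)).-1 * 2 ^ i + (2 ^ i).-1.
  apply: succn_inj; rewrite -addnS !prednK ?expn_gt0 //.
  by rewrite -{2}[2 ^ i]mul1n -mulnDl addn1 prednK ?expn_gt0 // -expnD subnK // ltnW.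
rewrite divnMDl ?expn_gt0 // divn_small ?prednK ?expn_gt0 // addn0.
have : 0 < 2 ^ (m - i) by rewrite expn_gt0.
have : ~~ odd (2 ^ (m - i)) by rewrite oddX subn_eq0 leqNgt im.
by case: (2 ^ (m - i)) => // k /=; rewrite negbK.
Qed.

Lemma odd_pow2_add m i k : i < m -> odd ((2 ^ m + k) %/ 2 ^ i) = odd (k %/ 2 ^ i).
Proof.
move=> im; rewrite -{1}(subnK (ltnW im)) expnD divnMDl ?expn_gt0 // oddD oddX.
by rewrite subn_eq0 leqNgt im.
Qed.

Hypothesis q2xxyy : forall x y : A, eval (vec4 x x y y) q2 = y.

(** Gives the first stage the shape of the later ones, with the degenerate cube [flat i false g] as
    previous stage. *)
Lemma hat_upto2 (i d : 'I_n) g : i = 0 :> nat -> d = 1 :> nat ->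
  hat_upto 2 g =
  [ffun f : {ffun 'I_n -> bool} => if f d
     then eval (vec4 (flat i false g (upd f d false)) (g (upd f d false))
                     (flat i false g f) (g f)) q2
     else g f].
Proof.
move=> i0 d1; apply/ffunP => f; rewrite [LHS]ffunE [RHS]ffunE.
have id : i != d by rewrite -(inj_eq val_inj) /= i0 d1.
have small (k : 'I_n) : k < 2 -> k = i \/ k = d.
  by case: k => -[|[|//]] ? _; [left|right]; apply: val_inj; rewrite /= ?i0 ?d1.
have -> : ones_upto 2 f = f i && f d.
  apply/ones_uptoP/andP => [h|[fi fd] k /small [] -> //].
  by split; apply: h; rewrite ?i0 ?d1.
case: (boolP (f d)) => fd; last by rewrite andbF.
rewrite andbT; case: ifP => fi; last first.
  by rewrite !ffunE [upd (upd _ _ _) _ _]upd_id ?(upd_id fi) // upd_diff.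
rewrite eval_qterm2 !ffunE; congr (eval (vec4 (g _) (g _) (g _) (g _)) _);
  apply/ffunP => k; rewrite !ffunE; (case: ltnP => [/small [] ->|k2]);
  rewrite ?eqxx ?(negbTE id) ?[d == i]eq_sym ?(negbTE id) ?i0 ?d1 ?fi ?fd //.
all: have kd : (k == d) = false by rewrite -(inj_eq val_inj) /= d1 gtn_eqF.
all: have ki : (k == i) = false by rewrite -(inj_eq val_inj) /= i0 gtn_eqF // ltnW.
all: by rewrite ?kd ?ki.
Qed.

Lemma hat_uptoS (d : 'I_n) g : 1 < d ->
  hat_upto d.+1 g =
  [ffun f : {ffun 'I_n -> bool} => if f d
     then eval (vec4 (hat_upto d g (upd f d false)) (g (upd f d false))
                     (hat_upto d g f) (g f)) q2
     else g f].
Proof.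
move=> d1; apply/ffunP => f; rewrite [LHS]ffunE [RHS]ffunE ones_uptoS.
case: (boolP (f d)) => fd; last by rewrite andbF.
rewrite andbT [hat_upto d g _]ffunE [hat_upto d g f]ffunE ones_upto_upd.
(* Where a coordinate below [d] is 0 the previous stage equals [g], and [q2] is evaluated at a tuple
   x, x, y, y. *)
case: ifP => [/ones_uptoP ones|_]; last by rewrite q2xxyy.
(* Indices below [2 ^ d] have coordinate [d] equal to 0, the next [2 ^ d] have it equal to 1; the
   last index of each half has only ones below [d]. *)
rewrite eval_qtermS //; congr (eval (vec4 _ (g _) _ (g _)) _).
- apply: eq_eval_qterm => // k k2; congr (g _); apply/ffunP => l; rewrite !ffunE ltnS.
  case: (ltngtP l d) => // [ld|/val_inj ->].
  + by case: eqP => // ld'; rewrite ld' ltnn in ld.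
  + by rewrite divn_small // eqxx.
- apply/ffunP => l; rewrite !ffunE ltnS.
  case: (ltngtP l d) => [ld|ld|/val_inj ->].
  + rewrite odd_pow2_pred // ones //.
    by case: eqP => // ld'; rewrite ld' ltnn in ld.
  + by case: eqP => // ld'; rewrite ld' ltnn in ld.
  + by rewrite divn_small ?eqxx // prednK ?expn_gt0.
- apply: eq_eval_qterm => // k k2; congr (g _); apply/ffunP => l; rewrite !ffunE ltnS.
  case: (ltngtP l d) => // [ld|/val_inj ->]; first by rewrite odd_pow2_add.
  by rewrite -{1}[2 ^ d]mul1n divnMDl ?expn_gt0 // divn_small // fd.
- apply/ffunP => l; rewrite !ffunE ltnS; case: leqP => // ld.
  rewrite odd_pow2_pred ?ltnS //; move: ld; rewrite leq_eqVlt.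
  by case/orP=> [/eqP /val_inj -> //|/ones ->].
Qed.

Lemma hat_upto_off m g f : ~~ ones_upto m f -> hat_upto m g f = g f.
Proof. by rewrite ffunE => /negbTE ->. Qed.

End PartialHat.

(** * Induction over the directions *)

Theorem theorem3p5 (sg : signature) (Sigma : term sg nat * term sg nat -> Prop)
    (q2 : term sg 'I_4) :
  congruence_modular_variety Sigma -> kiss_term Sigma q2 ->
  forall A : algebra sg, in_variety Sigma A ->
  forall n : nat, 2 <= n ->
  forall th : 'I_n -> A -> A -> Prop, (forall k, is_congruence A (th k)) ->
  forall g : cube A 'I_n,
    (forall (i : 'I_n) (j : bool),
        Delta (fun k : {k : 'I_n | k != i} => th (val k)) (face i j g)) ->
    Delta th (hat q2 g).
Proof.
move=> mod kiss A VA n n2 th _ g faces.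
have hD := Delta_higher_congruence th.
have {}faces i j : Delta th (flat i j g) by apply: Delta_face.
have q2xxyy (x y : A) : eval (vec4 x x y y) q2 = y by case: (kiss.1 A VA x y).
(* Every vertex modified at any stage has coordinate 0 equal to 1, so this one direction serves for
   shifting in all steps. *)
pose i : 'I_n := Ordinal (ltnW n2).
rewrite -hat_upto_all; suff H m : m.+2 <= n -> Delta th (hat_upto q2 m.+2 g).
  have e : n.-2.+2 = n by move: (n2); case: (n) => [|[|]].
  by rewrite -[X in hat_upto _ X](e); apply: H; rewrite e.
elim: m => [|m IH] mn.
  pose d : 'I_n := Ordinal mn.
  rewrite (@hat_upto2 _ _ _ _ q2xxyy i d) //.
  (* Here [flat i false g] may differ from [g] on the whole 1-face in direction [i], hence this
     choice of [S]. *)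
  apply: (@kiss_step sg Sigma A _ (Delta th) i d (fun f => f i)) => //.
  - by move=> f j; rewrite upd_diff.
  - by move=> f /negbTE fi; rewrite ffunE upd_id.
pose d : 'I_n := Ordinal mn.
rewrite (@hat_uptoS _ _ _ _ q2xxyy d) //.
apply: (@kiss_step sg Sigma A _ (Delta th) i d (ones_upto d)) => //.
- by move=> f /ones_uptoP; apply.
- by move=> f j; apply: ones_upto_upd.
- by apply: IH; apply: ltnW.
- exact: hat_upto_off.
Qed.
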